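(* Let $\pi^*$ be the optimal objective function value of the stochastic optimization problem $$\max_{\mathcal X}\ \mathcal G(\mathcal X):=E_{\tilde{\mathcal Q}}\Big(\sum_{k=1}^K g_k(x_k,\tilde Q_k)\Big)\quad\text{s.t. } \sum_{k=1}^K w_kx_k\le W,\ x_k\in\mathbb Z^+,\ k=1,\dots,K,$$ and let $\Pi^*_\Psi$ be the optimal objective function value of its sample average approximation $$\max_{\mathcal X}\ \mathcal G^\Psi(\mathcal X):=\frac1\Psi\sum_{\psi=1}^\Psi\sum_{k=1}^K g_k(x_k,\tilde Q_k^{(\psi)})\quad\text{s.t. } \sum_{k=1}^K w_kx_k\le W,\ x_k\in\mathbb Z^+,\ k=1,\dots,K.$$ Then, with probability one, $$\lim_{\Psi\to\infty}\sup|\Pi^*_\Psi-\pi^*|=0,$$ i.e. $\Pi_\Psi^*\to\pi^*$ as $\Psi\to\infty$.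
   Context: $\mathcal X=(x_1,\dots,x_K)$ is the vector of decision variables (requested quantities of $K$ resource types); $\mathbb Z^+$ is the set of nonnegative integers; $W>0$ is the transportation capacity and $w_k>0$ the capacity consumed by one unit of type $k$. Times: $T_-<T<T_+$ are fixed (disaster time, request time, arrival time of requested resources), and $\xi_k>T_+$ is a fixed time. Fixed parameters: $\phi\in\mathbb R$, $b>0$, and importance scores $c_k>1$. The deprivation cost reduction is $B^k(t)=e^{\phi-bc_kt}(e^{bc_k\xi_k}-e^{bc_kT_+})$, which is positive and decreasing in $t$. Net demands: $\tilde{\mathcal Q}=(\tilde Q_1,\dots,\tilde Q_K)$ is random, where $\tilde Q_k=\langle(\tilde t^k_j,\tilde q^k_j):j=1,\dots,\tilde n^k\rangle$ is a (random, finite) sequence of net demands for type $k$ waiting to be fulfilled by time $T_+$, with arrival times $\tilde t^k_1\le\dots\le\tilde t^k_{\tilde n^k}$ in $[T_-,T_+]$ and positive integer quantities $\tilde q^k_j$. (It is obtained from the stochastic sequence of demands in $(T,T_+]$ by merging it with the known $U_k$ units of demand unfulfilled at time $T$, or by removing its first $R_k$ units, where $R_k$ is the quantity of resources remaining at time $T$ and $U_kR_k=0$.) Put $|\tilde Q_k|=\sum_{j=1}^{\tilde n^k}\tilde q_j^k$ and $B^k_j=B^k(\tilde t^k_j)$, so $B^k_1\ge\dots\ge B^k_{\tilde n^k}>0$. Cost reduction function: for $x_k\ge0$, let $J^k$ be the largest index $J\in\{0,\dots,\tilde n^k\}$ with $\sum_{j=1}^J\tilde q_j^k\le x_k$, and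 $$g_k(x_k,\tilde Q_k)=\begin{cases}\sum_{j=1}^{J^k}\tilde q^k_jB^k_j+\big(x_k-\sum_{j=1}^{J^k}\tilde q^k_j\big)B^k_{J^k+1}&\text{if }x_k<|\tilde Q_k|,\\ \sum_{j=1}^{\tilde n^k}\tilde q^k_jB^k_j&\text{if }x_k\ge|\tilde Q_k|.\end{cases}$$ Samples: $\tilde{\mathcal Q}^{(\psi)}=(\tilde Q_1^{(\psi)},\dots,\tilde Q_K^{(\psi)})$, $\psi=1,2,\dots$, are independent samples from the distribution of $\tilde{\mathcal Q}$. *)

(* Defs.v *)
From HB Require Import structures.
From mathcomp Require Import all_boot all_order all_algebra.
From mathcomp Require Import all_classical all_reals all_analysis.

Set Implicit Arguments.
Unset Strict Implicit.
Unset Printing Implicit Defensive.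

Import Order.TTheory GRing.Theory Num.Theory.
Import numFieldNormedType.Exports.

Local Open Scope classical_set_scope.
Local Open Scope ring_scope.

HB.instance Definition _ (T : choiceType) := isPointed.Build (seq T) [::].

(* Finite sequences of random length: the sigma-algebra below is that of the
   disjoint union of the powers T^n. It is generated by the length and by the
   entries, the j-th entry being observed only where it exists. *)
Definition seq_cylinders d (T : measurableType d) : set (set (seq T)) :=
  [set A | exists n : nat, A = [set s | size s = n]] `|`
  [set A | exists (j : nat) (B : set T),
    measurable B /\ A = [set s | (j < size s)%N /\ B (nth point s j)]].

Definition measurable_seq d (T : measurableType d) :=
  g_sigma_algebraType (@seq_cylinders d T).

(* A sequence of pairs (arrival time, quantity). *)
Definition demand_seq (R : realType) := measurable_seq (R * nat)%type.

Section Demands.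
Context {R : realType}.

(* Entries are numbered from 0: [demand_time s j] is the time of the
   (j+1)-st demand. *)
Definition demand_time (s : seq (R * nat)) (j : nat) : R :=
  (nth (0, 0%N) s j).1.

Definition demand_qty (s : seq (R * nat)) (j : nat) : nat :=
  (nth (0, 0%N) s j).2.

Definition is_net_demand (Tminus Tplus : R) (s : seq (R * nat)) : Prop :=
  [/\ sorted <=%R [seq e.1 | e <- s],
      forall j, (j < size s)%N -> Tminus <= demand_time s j <= Tplus
    & forall j, (j < size s)%N -> (0 < demand_qty s j)%N].

Definition cumulated_qty (s : seq (R * nat)) (J : nat) : nat :=
  (\sum_(0 <= j < J) demand_qty s j)%N.

Definition total_qty (s : seq (R * nat)) : nat := cumulated_qty s (size s).

Definition deprivation_reduction (phi b c xi Tplus t : R) : R :=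
  expR (phi - b * c * t) * (expR (b * c * xi) - expR (b * c * Tplus)).

(* For 0 <= x the maximum is over a nonempty set, since J = 0 qualifies. *)
Definition last_fulfilled (s : seq (R * nat)) (x : R) : nat :=
  (\max_(J < (size s).+1 | ((cumulated_qty s J)%:R <= x)%R) J)%N.

(* [B] is the deprivation cost reduction as a function of time; with numbering
   from 0, the first demand not entirely fulfilled has index J. *)
Definition cost_reduction (B : R -> R) (x : R) (s : seq (R * nat)) : R :=
  let J := last_fulfilled s x in
  if x < (total_qty s)%:R then
    \sum_(0 <= j < J) (demand_qty s j)%:R * B (demand_time s j)
      + (x - (cumulated_qty s J)%:R) * B (demand_time s J)
  else
    \sum_(0 <= j < size s) (demand_qty s j)%:R * B (demand_time s j).

Definition total_reduction (K : nat) (B : 'I_K -> R -> R) (x : 'I_K -> nat)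
    (q : K.-tuple (demand_seq R)) : R :=
  \sum_(k < K) cost_reduction (B k) (x k)%:R (tnth q k).

Definition feasible (K : nat) (W : R) (w : 'I_K -> R) : set ('I_K -> nat) :=
  [set x | \sum_(k < K) w k * (x k)%:R <= W].

(* The supremum is attained when the feasible set is finite and nonempty, as is
   [feasible W w] for positive W and w. *)
Definition optimal_value (X : Type) (D : set X) (f : X -> \bar R) : \bar R :=
  ereal_sup [set f x | x in D].

(* Samples are numbered from 0; the value at Psi = 0 is the junk value 0. *)
Definition sample_average (V : Type) (h : V -> R) (v : nat -> V)
    (Psi : nat) : R :=
  Psi%:R^-1 * \sum_(0 <= psi < Psi) h (v psi).

End Demands.

Section Sampling.
Context d d' (Omega : measurableType d) (V : measurableType d') (R : realType).

Definition mutually_independent (P : probability Omega R)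
    (X : nat -> {RV P >-> V}) : Prop :=
  forall (I : seq nat) (A : nat -> set V),
    uniq I -> (forall i, measurable (A i)) ->
    P (\bigcap_(i in [set` I]) (X i @^-1` A i)) =
    (\prod_(i <- I) P (X i @^-1` A i))%E.

Definition sampled_from d0 (Omega0 : measurableType d0)
    (P0 : probability Omega0 R) (X0 : {RV P0 >-> V})
    (P : probability Omega R) (X : nat -> {RV P >-> V}) : Prop :=
  mutually_independent X /\
  forall i (A : set V), measurable A ->
    distribution P (X i) A = distribution P0 X0 A.

End Sampling.

(* Main.v *)
(* Demand j receives min(q_j, (x - q_1 - ... - q_(j-1))^+) units, so g_k(x_k, .)
   is a measurable function of the demand sequence, bounded by
   x_k B^k(T_-). The strong law for bounded independent samples therefore
   applies to each of the finitely many feasible x, and a maximum over a finite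
   set passes to the limit. The strong law itself comes from second moments:
   E[S_n^2] = O(n) makes (S_(k^2) / k^2)^2 summable in expectation, hence
   S_(k^2) / k^2 -> 0 almost surely, and boundedness of the increments fills
   the gaps between consecutive squares. *)

Require Import Defs.
From HB Require Import structures.
From mathcomp Require Import all_boot all_order all_algebra.
From mathcomp Require Import all_classical all_reals all_analysis.
From mathcomp Require Import measurable_realfun ring lra zify.

Set Implicit Arguments.
Unset Strict Implicit.
Unset Printing Implicit Defensive.

Import Order.TTheory GRing.Theory Num.Theory.
Import numFieldNormedType.Exports.

Local Open Scope classical_set_scope.
Local Open Scope ring_scope.

(** * Greedy allocation formula and uniform bounds for the cost reduction *)

Section CostReduction.
Context {R : realType}.
Implicit Types (B : R -> R) (s : seq (R * nat)).

Lemma leq_cumulated_qty s J J' : (J <= J')%N ->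
  (cumulated_qty s J <= cumulated_qty s J')%N.
Proof.
by move=> JJ'; rewrite /cumulated_qty [leqRHS](big_cat_nat (leq0n J) JJ')
  /= leq_addr.
Qed.

Lemma cumulated_qtyS s J :
  cumulated_qty s J.+1 = (cumulated_qty s J + demand_qty s J)%N.
Proof. by rewrite /cumulated_qty big_nat_recr. Qed.

Lemma last_fulfilledP s (n : nat) :
  [/\ (last_fulfilled s (n%:R : R) <= size s)%N,
      (cumulated_qty s (last_fulfilled s (n%:R : R)) <= n)%N &
      forall J, (J <= size s)%N -> (cumulated_qty s J <= n)%N ->
        (J <= last_fulfilled s (n%:R : R))%N].
Proof.
rewrite /last_fulfilled.
pose P (J : 'I_(size s).+1) := (cumulated_qty s J)%:R <= (n%:R : R).
have maxP J' : (J' <= size s)%N -> (cumulated_qty s J' <= n)%N ->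
    (J' <= \max_(J < (size s).+1 | P J) J)%N.
  move=> J's cJ'; have J'S : (J' < (size s).+1)%N by rewrite ltnS.
  by apply: (@leq_bigmax_cond _ P val (Ordinal J'S)); rewrite /P /= ler_nat.
have P0 : P ord0 by rewrite /P /cumulated_qty big_geq.
split; last exact: maxP.
  have [|J PJ ->] := @eq_bigmax_cond _ P val; last by rewrite -ltnS ltn_ord.
  by apply/card_gt0P; exists ord0.
have [|J PJ ->] := @eq_bigmax_cond _ P val.
  by apply/card_gt0P; exists ord0.
by rewrite -(ler_nat R).
Qed.

(* The subtraction of naturals is truncated: it is the positive part that
   demand j can still receive. *)
Lemma cost_reductionE B (n : nat) s :
  cost_reduction B n%:R s = \sum_(0 <= j < size s)
    (minn (demand_qty s j) (n - cumulated_qty s j))%:R * B (demand_time s j).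
Proof.
rewrite /cost_reduction; set J := last_fulfilled s _.
have [Js cJ maxJ] := last_fulfilledP s n; rewrite -/J in Js cJ maxJ.
have full j : (cumulated_qty s j.+1 <= n)%N ->
    minn (demand_qty s j) (n - cumulated_qty s j) = demand_qty s j.
  rewrite cumulated_qtyS => h; apply/minn_idPl.
  by rewrite leq_subRL ?(leq_trans (leq_addr _ _) h).
rewrite ltr_nat; case: ltnP => [nt|tn]; last first.
  apply: eq_big_nat => j /andP[_ js]; rewrite full//.
  by rewrite (leq_trans _ tn)// leq_cumulated_qty.
(* The total demand exceeds n here, so J cannot be the full length. *)
have {}Js : (J < size s)%N.
  rewrite ltn_neqAle Js andbT; apply: contraTneq nt => Js'.
  by rewrite -leqNgt /total_qty -Js'.
rewrite [RHS](big_cat_nat (leq0n J) (ltnW Js)) /=; congr (_ + _).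
  apply: eq_big_nat => j /andP[_ jJ]; rewrite full//.
  by rewrite (leq_trans _ cJ)// leq_cumulated_qty.
(* By maximality of J, demand J gets only the remaining [n - cumulated_qty s J] units, and the
   truncated subtraction gives 0 to every later demand. *)
have cJ1 : (n < cumulated_qty s J.+1)%N.
  by rewrite ltnNge; apply/negP => /(maxJ _ Js); rewrite ltnn.
rewrite big_ltn// big1_seq ?addr0.
  rewrite (minn_idPr _) ?natrB// leq_subLR -cumulated_qtyS; exact: ltnW.
move=> j /=; rewrite mem_index_iota => /andP[Jj _].
rewrite (_ : n - cumulated_qty s j = 0)%N ?minn0 ?mul0r//.
by apply/eqP; rewrite subn_eq0 (leq_trans (ltnW cJ1))// leq_cumulated_qty.
Qed.

(** No more than n units are ever handed out. This makes the bound on the cost reduction independent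
    of the length and the quantities of the random sequence. *)
Lemma sum_minn_cumulated_qty s (n J : nat) :
  (\sum_(0 <= j < J) minn (demand_qty s j) (n - cumulated_qty s j) =
   minn n (cumulated_qty s J))%N.
Proof.
elim: J => [|J IH]; first by rewrite big_geq// /cumulated_qty big_geq// minn0.
by rewrite big_nat_recr//= IH cumulated_qtyS; lia.
Qed.

(** At most n units are distributed, each worth at most M. The maximum with 0 covers the empty
    sequence, for which the hypothesis does not force M to be nonnegative. *)
Lemma cost_reduction_itv B (M : R) (n : nat) s :
  (forall j, (j < size s)%N -> 0 <= B (demand_time s j) <= M) ->
  0 <= cost_reduction B n%:R s <= n%:R * Num.max M 0.
Proof.
move=> BM; rewrite cost_reductionE; apply/andP; split.
  rewrite big_seq sumr_ge0// => j; rewrite mem_index_iota => /= /BM/andP[? _].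
  by rewrite mulr_ge0.
apply: (@le_trans _ _ (\sum_(0 <= j < size s)
    (minn (demand_qty s j) (n - cumulated_qty s j))%:R * Num.max M 0)).
  apply: ler_sum_nat => j /BM/andP[_ ?].
  by rewrite ler_wpM2l// le_max; apply/orP; left.
rewrite -mulr_suml -natr_sum sum_minn_cumulated_qty ler_wpM2r//.
  by rewrite le_max lexx orbT.
by rewrite ler_nat geq_minl.
Qed.

(** Monotonicity in time yields a bound valid for all arrival times at once, namely the value at
    [Tminus]. *)
Lemma deprivation_reduction_itv (phi b c xi Tplus Tminus t : R) :
  0 < b -> 1 < c -> Tplus < xi -> Tminus <= t ->
  0 <= deprivation_reduction phi b c xi Tplus t
    <= deprivation_reduction phi b c xi Tplus Tminus.
Proof.
move=> b0 c1 Txi Tt; rewrite /deprivation_reduction.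
have bc0 : 0 < b * c by rewrite mulr_gt0// (lt_trans ltr01).
have d0 : 0 <= expR (b * c * xi) - expR (b * c * Tplus).
  by rewrite subr_ge0 ler_expR ler_pM2l// ltW.
rewrite mulr_ge0 ?expR_ge0//= ler_wpM2r// ler_expR lerD2l lerN2.
by rewrite ler_pM2l.
Qed.

End CostReduction.

(** * Measurable functions of sequences of random length *)

Section Measurability.

(** A preimage is the countable union, over n, of its parts where N equals n. Used below for sums
    whose number of terms is random. *)
Lemma measurable_fun_countable_split d d' (T : measurableType d)
    (V : measurableType d') (N : T -> nat) (F : nat -> T -> V) :
  measurable_fun setT N -> (forall n, measurable_fun setT (F n)) ->
  measurable_fun setT (fun x => F (N x) x).
Proof.
move=> mN mF _ A mA; rewrite setTI.
rewrite [X in measurable X](_ : _ =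
    \bigcup_n (N @^-1` [set n] `&` F n @^-1` A)); last first.
  apply/seteqP; split => [x /= Ax|x [n _ [/= <-]]//].
  by exists (N x).
apply: bigcupT_measurable => n; apply: measurableI.
  by rewrite -[X in measurable X]setTI; exact: mN.
by rewrite -[X in measurable X]setTI; exact: mF.
Qed.

Context d (T : measurableType d).

Lemma measurable_size : measurable_fun setT (size : measurable_seq T -> nat).
Proof.
move=> _ A _; rewrite setTI.
rewrite [X in measurable X](_ : _ = \bigcup_(n in A) [set s | size s = n]).
  apply: bigcup_measurable => n _; apply: sub_sigma_algebra.
  by left; exists n.
by apply/seteqP; split => [s /= As|s [n An /= ->]//]; exists (size s).
Qed.

(** Where entry j exists, the preimage is a generating cylinder. Elsewhere the function is
    constantly x, so the preimage contains either all or none of the sequences of size at most j. *)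
Lemma measurable_nth (x : T) (j : nat) :
  measurable_fun setT (nth x ^~ j : measurable_seq T -> T).
Proof.
move=> _ A mA; rewrite setTI.
rewrite [X in measurable X](_ : _ =
  [set s | (j < size s)%N /\ A (nth point s j)] `|`
  ([set s | (size s <= j)%N] `&` [set _ | A x])).
  apply: measurableU.
    by apply: sub_sigma_algebra; right; exists j, A.
  have [Ax|Ax] := pselect (A x); last first.
    by rewrite [X in _ `&` X](_ : _ = set0) ?setI0//; apply/seteqP; split.
  rewrite [X in _ `&` X](_ : _ = setT) ?setIT; last by apply/seteqP; split.
  have := @measurable_size measurableT [set n | (n <= j)%N].
  by rewrite setTI; apply.
apply/seteqP; split => [s /=|s /= [[js]|[sj Ax]]].
- case: (ltnP j (size s)) => js As; [left|right].
    by rewrite (set_nth_default x).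
  by rewrite nth_default in As.
- by rewrite (set_nth_default x).
- by rewrite nth_default.
Qed.

End Measurability.

(** * Measurability of the cost reduction in the demand sequence *)

Section MeasurableReduction.
Context {R : realType}.

Lemma measurable_demand_time (j : nat) :
  measurable_fun setT (demand_time ^~ j : demand_seq R -> R).
Proof.
exact: (measurableT_comp measurable_fst (measurable_nth _ _)).
Qed.

Lemma measurable_demand_qty (j : nat) :
  measurable_fun setT (demand_qty ^~ j : demand_seq R -> nat).
Proof.
exact: (measurableT_comp measurable_snd (measurable_nth _ _)).
Qed.

Lemma measurable_cumulated_qty (J : nat) :
  measurable_fun setT (cumulated_qty ^~ J : demand_seq R -> nat).
Proof.
elim: J => [|J IH].
  by under eq_fun do rewrite /cumulated_qty big_geq//; exact: measurable_cst.
under eq_fun do rewrite cumulated_qtyS.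
by apply: measurable_fun_addn => //; exact: measurable_demand_qty.
Qed.

(** In the form of [cost_reductionE], each sum of fixed length m is measurable; the random length is
    then handled by splitting over its values. *)
Lemma measurable_cost_reduction (B : R -> R) (n : nat) :
  measurable_fun setT B ->
  measurable_fun setT (cost_reduction B n%:R : demand_seq R -> R).
Proof.
move=> mB.
pose F m (s : demand_seq R) := \sum_(0 <= j < m)
  (minn (demand_qty s j) (n - cumulated_qty s j))%:R * B (demand_time s j).
rewrite (_ : cost_reduction B n%:R = fun s => F (size s) s); last first.
  by apply/funext => s; exact: cost_reductionE.
apply: (@measurable_fun_countable_split _ _ (demand_seq R) R
  (size : demand_seq R -> nat) F) => [|m]; first exact: measurable_size.
apply: measurable_sum => j; apply: measurable_funM.
  apply: (@measurableT_comp _ _ _ _ _ _ (fun k : nat => k%:R : R)) => //.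
  (* The minimum of p and q is [p - (p - q)], so measurability of truncated subtraction suffices. *)
  under eq_fun do rewrite minnE.
  apply: measurable_fun_subn; first exact: measurable_demand_qty.
  apply: measurable_fun_subn; first exact: measurable_demand_qty.
  apply: measurable_fun_subn; first exact: measurable_cst.
  exact: measurable_cumulated_qty.
exact: (measurableT_comp mB (measurable_demand_time j)).
Qed.

Lemma measurable_deprivation_reduction (phi b c xi Tplus : R) :
  measurable_fun setT (deprivation_reduction phi b c xi Tplus).
Proof.
apply: measurable_funM => //; apply: measurableT_comp => //.
by apply: measurable_funB => //; exact: measurable_funM.
Qed.

Lemma measurable_total_reduction (K : nat) (B : 'I_K -> R -> R)
    (x : 'I_K -> nat) : (forall k, measurable_fun setT (B k)) ->
  measurable_fun setT (total_reduction B x).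
Proof.
move=> mB; apply: measurable_sum => k.
exact: (measurableT_comp (measurable_cost_reduction _ (mB k))
  (measurable_tnth k)).
Qed.

End MeasurableReduction.

(** * From averages along squares to all averages *)

Section SquareSubsequence.
Context {R : realType}.

Lemma ex_sqrtn (n : nat) : exists k, (k ^ 2 <= n < k.+1 ^ 2)%N.
Proof.
elim: n => [|n [k /andP[kn nk]]]; first by exists 0.
have [nk'|nk'] := ltnP n.+1 (k.+1 ^ 2); first by exists k; lia.
by exists k.+1; apply/andP; split => //; nia.
Qed.

Lemma le_dist_increments (u : nat -> R) (C : R) (m n : nat) :
  (forall i, `|u i.+1 - u i| <= C) -> (m <= n)%N ->
  `|u n - u m| <= (n - m)%:R * C.
Proof.
move=> uC; elim: n => [|n IH].
  by rewrite leqn0 => /eqP ->; rewrite !subrr normr0 mul0r.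
rewrite leq_eqVlt => /predU1P[->|]; first by rewrite subrr subnn normr0 mul0r.
rewrite ltnS => mn; rewrite subSn// -natr1 mulrDl mul1r.
have -> : u n.+1 - u m = (u n - u m) + (u n.+1 - u n) by ring.
by rewrite (le_trans (ler_normD _ _))// lerD// IH.
Qed.

(** If n lies between [k ^ 2] and [k.+1 ^ 2], then [u n] differs from [u (k ^ 2)] by at most 2kC,
    which is negligible against n. The hypothesis is squared because it will come from second
    moments. *)
Lemma cvg_average_of_squares (u : nat -> R) (C : R) :
  (forall i, `|u i.+1 - u i| <= C) ->
  ((k.+1 ^ 2)%:R^-1 * u (k.+1 ^ 2)%N) ^+ 2 @[k --> \oo] --> 0 ->
  n%:R^-1 * u n @[n --> \oo] --> 0.
Proof.
move=> uC /cvgrPdist_lt u2; apply/cvgrPdist_le => e e0.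
have C0 : 0 <= C by rewrite (le_trans _ (uC 0%N)).
have e2 : 0 < (e / 2) ^+ 2 by rewrite exprn_gt0// divr_gt0.
have [K _ KP] := u2 _ e2.
(* For k at least N, the first summand puts the shifted index [k.-1] beyond K, and the second gives
   4C <= ke, so that the gap 2kC is at most half of [k ^ 2 * e]. Taking n at least [N ^ 2] forces k
   to be at least N. *)
pose N := (K.+1 + (Num.truncn (4 * C / e)).+1)%N.
exists (N ^ 2)%N => // n /= Nn.
have [k /andP[kn nk]] := ex_sqrtn n.
have Nk : (N <= k)%N by nia.
have k0 : (0 < k)%N by lia.
have kR0 : 0 < k%:R :> R by rewrite ltr0n.
have n0 : 0 < n%:R :> R by rewrite ltr0n; nia.
have k2n : (k%:R ^+ 2 : R) <= n%:R by rewrite -natrX ler_nat.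
have k2 : 0 < k%:R ^+ 2 :> R by rewrite exprn_gt0.
have big : `|u (k ^ 2)%N| <= k%:R ^+ 2 * (e / 2).
  have := KP k.-1; rewrite /= prednK//= => /(_ ltac:(lia)).
  have e20 : 0 <= e / 2 by rewrite divr_ge0// ltW.
  rewrite sub0r normrN normrX ltr_pXn2r ?nnegrE//.
  rewrite normrM normfV (ger0_norm (ler0n _ _)) natrX => /ltW.
  by rewrite mulrC ler_pdivrMr// mulrC.
have small : 4 * C <= k%:R * e.
  rewrite -ler_pdivrMr//; apply/ltW/(lt_le_trans (truncnS_gt _)).
  by rewrite ler_nat (leq_trans _ Nk)// leq_addl.
rewrite sub0r normrN normrM normfV (ger0_norm (ler0n _ _)) mulrC ler_pdivrMr//.
have -> : u n = u (k ^ 2)%N + (u n - u (k ^ 2)%N) by ring.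
apply: (le_trans (ler_normD _ _)).
(* Since n is below [k.+1 ^ 2], its distance to [k ^ 2] is at most 2k. *)
have step : (n - k ^ 2)%:R * C <= 2 * k%:R * C.
  by rewrite ler_wpM2r// -natrM ler_nat; nia.
have := le_trans (le_dist_increments uC kn) step.
have : 2 * k%:R * C <= k%:R ^+ 2 * (e / 2).
  by have := ler_wpM2l (ltW kR0) small; nra.
have := ler_wpM2r (ltW e0) k2n; nra.
Qed.

(* Telescoping: 1 / (n + 1)^2 <= 1 / n - 1 / (n + 1). *)
Lemma sum_inv_squares_le (n : nat) :
  \sum_(0 <= k < n) ((k.+1 ^ 2)%:R)^-1 <= 2 :> R.
Proof.
case: n => [|n]; first by rewrite big_geq.
have : \sum_(0 <= k < n.+1) ((k.+1 ^ 2)%:R)^-1 <= 2 - n.+1%:R^-1 :> R.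
  elim: n => [|n IH]; first by rewrite big_nat1 invr1; lra.
  rewrite big_nat_recr//= (le_trans (lerD IH (lexx _)))//.
  have : (n.+2 ^ 2)%:R^-1 <= n.+1%:R^-1 - n.+2%:R^-1 :> R.
    have -> : n.+1%:R^-1 - n.+2%:R^-1 = (n.+1 * n.+2)%:R^-1 :> R.
      rewrite natrM -(natr1 n.+1); set a : R := n.+1%:R.
      have a0 : 0 < a by rewrite ltr0n.
      by field; rewrite !gt_eqF// addr_gt0.
    by rewrite lef_pV2 ?posrE ?ltr0n// ler_nat; nia.
  by move=> h; rewrite -addrA lerD2l addrC lerBlDr [leRHS]addrC.
by move=> /le_trans; apply; rewrite gerBl invr_ge0.
Qed.

End SquareSubsequence.

(** * Strong law for bounded orthogonal variables *)

Section StrongLaw.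
Context d (T : measurableType d) (R : realType) (P : probability T R).

Lemma bounded_integrable (f : T -> R) (C : R) :
  measurable_fun setT f -> (forall w, `|f w| <= C) ->
  P.-integrable setT (EFin \o f).
Proof.
move=> mf fC; apply: measurable_bounded_integrable => //.
  by rewrite (le_lt_trans (probability_le1 _ _))// ltry.
exists C; split; first exact: num_real.
by move=> x Cx y _; exact: le_trans (fC y) (ltW Cx).
Qed.

Section Orthogonal.
Variables (Y : nat -> T -> R) (C : R).
Hypothesis mY : forall i, measurable_fun setT (Y i).
Hypothesis YC : forall i w, `|Y i w| <= C.
Hypothesis orthY : forall i j, i != j -> \int[P]_w (Y i w * Y j w) = 0.

Let S n w := \sum_(0 <= i < n) Y i w.

Let mS n : measurable_fun setT (S n).
Proof. exact: measurable_sum. Qed.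

Let SC n w : `|S n w| <= n%:R * C.
Proof.
rewrite (le_trans (ler_norm_sum _ _ _))//.
rewrite (le_trans (ler_sum _ (fun i _ => YC i w)))//.
by rewrite sumr_const_nat subn0 mulr_natl.
Qed.

Let C0 : 0 <= C.
Proof. exact: le_trans (YC 0 point). Qed.

Let SYC n j w : `|S n w * Y j w| <= n%:R * C * C.
Proof. by rewrite normrM ler_pM. Qed.

Let mSY n j : measurable_fun setT (fun w => S n w * Y j w).
Proof. exact: measurable_funM. Qed.

Let S_S n w : S n.+1 w = S n w + Y n w.
Proof. by rewrite /S big_nat_recr. Qed.

Let orthS n j : (n <= j)%N -> \int[P]_w (S n w * Y j w) = 0.
Proof.
elim: n => [|n IH] nj.
  under eq_Rintegral do rewrite /S big_geq// mul0r.
  by rewrite Rintegral_cst// mul0r.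
under eq_Rintegral do rewrite S_S mulrDl.
rewrite RintegralD//; first by rewrite IH ?orthY ?addr0 1?ltnW// neq_ltn nj.
- exact: bounded_integrable (SYC n j).
- apply: (@bounded_integrable _ (C * C)); first exact: measurable_funM.
  by move=> w; rewrite normrM ler_pM.
Qed.

Let mS2 n : measurable_fun setT (fun w => S n w ^+ 2).
Proof. exact: measurable_funX. Qed.

Let intS2 n : P.-integrable setT (EFin \o (fun w => S n w ^+ 2)).
Proof.
apply: (@bounded_integrable _ ((n%:R * C) ^+ 2)) => // w.
by rewrite normrX lerXn2r ?nnegrE// mulr_ge0.
Qed.

(** Expanding the square of [S n + Y n], the cross term integrates to 0 by orthogonality and the
    last square adds at most [C ^+ 2]. *)
Lemma second_moment_sum (n : nat) :
  \int[P]_w (S n w ^+ 2) <= n%:R * C ^+ 2.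
Proof.
elim: n => [|n IH].
  under eq_Rintegral do rewrite /S big_geq// expr0n.
  by rewrite Rintegral_cst// !mul0r.
have -> : \int[P]_w (S n.+1 w ^+ 2) =
    \int[P]_w (S n w ^+ 2 + (2 * (S n w * Y n w) + Y n w ^+ 2)).
  by apply: eq_Rintegral => w _; rewrite S_S; ring.
have iSY := bounded_integrable (mSY n n) (SYC n n).
have iSY2 : P.-integrable setT (EFin \o (fun w => 2 * (S n w * Y n w))).
  apply: (@bounded_integrable _ (2 * (n%:R * C * C))) => [|w].
    exact: measurable_funM.
  by rewrite normrM ger0_norm// ler_wpM2l.
have YC2 w : `|Y n w ^+ 2| <= C ^+ 2 by rewrite normrX lerXn2r ?nnegrE.
have mY2 : measurable_fun setT (fun w => Y n w ^+ 2) by exact: measurable_funX.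
have iY2 := bounded_integrable mY2 YC2.
rewrite RintegralD//; last first.
  apply: (@bounded_integrable _ (2 * (n%:R * C * C) + C ^+ 2)) => [|w].
    by apply: measurable_funD => //; exact: measurable_funM.
  rewrite (le_trans (ler_normD _ _))// lerD//.
  by rewrite normrM ger0_norm// ler_wpM2l.
rewrite RintegralD// RintegralZl// orthS// mulr0 add0r -natr1 mulrDl mul1r.
rewrite lerD//.
have -> : C ^+ 2 = \int[P]_w (C ^+ 2).
  by rewrite Rintegral_cst// [X in fine X]probability_setT mulr1.
apply: le_Rintegral => //.
  apply: (@bounded_integrable _ (C ^+ 2)) => // w.
  by rewrite ger0_norm ?sqr_ge0.
by move=> w _; rewrite (le_trans (ler_norm _)).
Qed.

Lemma bounded_orthogonal_strong_law :
  {ae P, forall w, n%:R^-1 * S n w @[n --> \oo] --> 0}.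
Proof.
(* The shift to [k.+1] avoids division by zero. *)
pose Z k w : R := ((k.+1 ^ 2)%:R^-1 * S (k.+1 ^ 2)%N w) ^+ 2.
have mZ k : measurable_fun setT (fun w => (Z k w)%:E).
  by apply/measurable_EFinP/measurable_funX; exact: measurable_funM.
have Z0 k w : (0 <= (Z k w)%:E)%E by rewrite lee_fin sqr_ge0.
(* With a = [k.+1 ^ 2], the second moment is at most a times [C ^+ 2], and dividing by the square of
   a leaves one factor 1/a. *)
have intZ k : (\int[P]_w (Z k w)%:E <= (C ^+ 2 * ((k.+1 ^ 2)%:R)^-1)%:E)%E.
  have -> : (\int[P]_w (Z k w)%:E = (\int[P]_w Z k w)%:E)%E.
    rewrite fineK//; apply: integrable_fin_num => //.
    apply: (@bounded_integrable _ (C ^+ 2)) => [|w].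
      exact/measurable_EFinP/mZ.
    rewrite /Z normrX lerXn2r ?nnegrE// normrM normfV (ger0_norm (ler0n _ _)).
    by rewrite ler_pdivrMl ?ltr0n ?expn_gt0.
  rewrite lee_fin; under eq_Rintegral do rewrite /Z exprMn.
  rewrite RintegralZl//.
  rewrite (le_trans (ler_wpM2l _ (second_moment_sum _))) ?sqr_ge0//.
  have : (k.+1 ^ 2)%:R != 0 :> R by rewrite pnatr_eq0 expn_eq0.
  move: (_%:R : R) => a a0.
  by rewrite le_eqVlt; apply/orP; left; apply/eqP; field.
(* The terms are nonnegative, so sum and integral commute; the inverse squares sum to at most 2. *)
have intsum : P.-integrable setT (fun w => \sum_(0 <= k <oo) (Z k w)%:E)%E.
  apply/integrableP; split.
    apply: ge0_emeasurable_sum => //.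
  under eq_integral do rewrite gee0_abs ?nneseries_ge0//.
  rewrite integral_nneseries//.
  apply: (@le_lt_trans _ _ (C ^+ 2 * 2)%:E); last exact: ltry.
  apply: lime_le.
    by apply: is_cvg_nneseries => k _ _; exact: integral_ge0.
  apply: nearW => n.
  apply: (le_trans (lee_sum _ (fun k _ => intZ k))).
  rewrite sumEFin lee_fin -mulr_sumr ler_wpM2l ?sqr_ge0//.
  exact: sum_inv_squares_le.
apply: filterS (integrable_ae measurableT intsum) => w /(_ I) finZ.
apply: (@cvg_average_of_squares _ (S^~ w) C).
  by move=> i; rewrite S_S addrC addKr.
rewrite -/(Z^~ w).
(* Where the sum of the [Z k w] is finite it bounds the nondecreasing partial sums, so the series
   converges and its terms tend to 0. *)
apply: cvg_series_cvg_0.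
apply: nondecreasing_is_cvgn.
  by apply: nondecreasing_series => k _ _; rewrite sqr_ge0.
exists (fine (\sum_(0 <= k <oo) (Z k w)%:E)%E) => _ [n _ <-].
rewrite -lee_fin fineK// /series/= -sumEFin.
exact: nneseries_lim_ge.
Qed.

End Orthogonal.
End StrongLaw.

(** * Laws of random variables and averages of independent samples *)

Lemma integrable_bounded_comp d d' (T : measurableType d)
    (V : measurableType d') (R : realType) (P : probability T R)
    (X : {RV P >-> V}) (f : V -> R) (C : R) :
  measurable_fun setT f -> (forall v, `|f v| <= C) ->
  P.-integrable setT (EFin \o (f \o X)).
Proof.
move=> mf fC; apply: (@bounded_integrable _ _ _ _ _ C) => [|w]; last exact: fC.
exact: measurableT_comp mf (measurable_funPT X).
Qed.

Lemma Rintegral_distribution d d' (T : measurableType d)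
    (V : measurableType d') (R : realType) (P : probability T R)
    (X : {RV P >-> V}) (f : V -> R) (C : R) :
  measurable_fun setT f -> (forall v, `|f v| <= C) ->
  \int[distribution P X]_v f v = \int[P]_w f (X w).
Proof.
move=> mf fC; congr fine; rewrite integral_distribution//.
  exact/measurable_EFinP.
exact: integrable_bounded_comp mf fC.
Qed.

Section IndependentSamples.
Context d d' (T : measurableType d) (V : measurableType d') (R : realType).
Variable P : probability T R.

(** Independence says that the law of the pair agrees with the product of the laws on rectangles,
    hence everywhere by uniqueness of the product measure; Fubini then factors the integral. *)
Lemma Rintegral_mul_independent (X Y : {RV P >-> V}) (f g : V -> R) (C : R) :
  measurable_fun setT f -> measurable_fun setT g ->
  (forall v, `|f v| <= C) -> (forall v, `|g v| <= C) ->
  (forall A B, measurable A -> measurable B ->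
    P (X @^-1` A `&` Y @^-1` B) = (P (X @^-1` A) * P (Y @^-1` B))%E) ->
  \int[P]_w (f (X w) * g (Y w)) = \int[P]_w f (X w) * \int[P]_w g (Y w).
Proof.
move=> mf mg fC gC indXY.
have mXY : measurable_fun setT (fun w => (X w, Y w)).
  by apply: measurable_fun_pair.
pose XY : {RV P >-> (V * V)%type} :=
  HB.pack (fun w => (X w, Y w)) (isMeasurableFun.Build _ _ _ _ _ mXY).
pose fg (z : V * V) := f z.1 * g z.2.
have mfg : measurable_fun setT fg.
  apply: measurable_funM; first exact: (measurableT_comp mf measurable_fst).
  exact: (measurableT_comp mg measurable_snd).
have fgC z : `|fg z| <= C * C by rewrite normrM ler_pM.
rewrite -(Rintegral_distribution X mf fC) -(Rintegral_distribution Y mg gC).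
rewrite [LHS](_ : _ = \int[distribution P XY]_z fg z); last first.
  by rewrite (Rintegral_distribution XY mfg fgC).
pose muX : probability V R := distribution P X.
pose muY : probability V R := distribution P Y.
have ifg : (muX \x muY)%E.-integrable setT (EFin \o fg).
  exact: (bounded_integrable _ mfg fgC).
have -> : \int[distribution P XY]_z fg z =
    fine (\int[(muX \x muY)%E]_z (fg z)%:E)%E.
  congr fine; apply: eq_measure_integral => A mA _; apply/esym.
  by apply: product_measure_unique => // A1 A2 mA1 mA2; exact: indXY.
rewrite -integral12_prod_meas1//.
have ifX : muX.-integrable setT (EFin \o f) by exact: bounded_integrable mf fC.
have igY : muY.-integrable setT (EFin \o g) by exact: bounded_integrable mg gC.
rewrite -RintegralZr//; congr fine; apply: eq_integral => x _.
rewrite /fubini_F /fg/=; under eq_integral do rewrite EFinM.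
by rewrite integralZl//= EFinM fineK//; exact: integrable_fin_num.
Qed.

Variables (X : nat -> {RV P >-> V}) (h : V -> R) (C : R).
Hypothesis mh : measurable_fun setT h.
Hypothesis hC : forall v, `|h v| <= C.

Lemma sample_average_cvg d0 (T0 : measurableType d0) (P0 : probability T0 R)
    (X0 : {RV P0 >-> V}) : sampled_from X0 X ->
  {ae P, forall w, sample_average h (fun i => X i w) n @[n --> \oo] -->
    \int[P0]_w h (X0 w)}.
Proof.
move=> [indX eqX]; set m := \int[P0]_w h (X0 w).
have meanX i : \int[P]_w h (X i w) = m.
  rewrite -(Rintegral_distribution (X i) mh hC).
  rewrite /m; congr fine.
  rewrite -[RHS](@integral_distribution _ _ _ _ _ P0 X0 (EFin \o h)).
  - by apply: eq_measure_integral => A mA _; exact: eqX.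
  - exact/measurable_EFinP.
  - exact: integrable_bounded_comp mh hC.
(* After centring, independent samples become orthogonal: the integral of a product is a product of
   zero means. *)
pose f v := h v - m.
have mf : measurable_fun setT f by exact: measurable_funB.
have fC v : `|f v| <= C + `|m|.
  by rewrite (le_trans (ler_normB _ _))// lerD2r.
have mean0 i : \int[P]_w f (X i w) = 0.
  rewrite RintegralB//.
  - by rewrite meanX Rintegral_cst// [X in fine X]probability_setT mulr1 subrr.
  - exact: integrable_bounded_comp mh hC.
  - exact: (@bounded_integrable _ _ _ _ (cst m) `|m|).
have := @bounded_orthogonal_strong_law _ T R P (fun i w => f (X i w))
  (C + `|m|).
move=> /(_ _ _ _)/wrap[].
- by move=> i; exact: measurableT_comp mf (measurable_funPT (X i)).
- by move=> i w.
- move=> i j ij; rewrite (Rintegral_mul_independent mf mf fC fC).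
    by rewrite mean0 mul0r.
  move=> A B mA mB.
  (* Pairwise independence is mutual independence for a two-element family of indices. *)
  have := indX [:: i; j] (fun k => if k == i then A else B).
  rewrite bigcap_seq !big_cons !big_nil eqxx [j == i]eq_sym (negbTE ij).
  rewrite setIT mule1; apply => [|k]; first by rewrite /= inE ij.
  by case: ifP.
apply: filterS => w cv.
(* The mean m is added back. The identity between the two averages holds only for nonzero n, as the
   average at 0 is 0. *)
rewrite -[X in _ --> X]add0r.
apply: cvg_trans; last by apply: cvgD cv _; exact: (cvg_cst m).
apply: near_eq_cvg; near=> n.
have n0 : n%:R != 0 :> R by rewrite pnatr_eq0 -lt0n; near: n; exists 1%N.
rewrite fctE /= /f sumrB sumr_const_nat subn0 mulrBr.
rewrite -[m *+ n]mulr_natl mulrA mulVf// mul1r.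
by rewrite subrK.
Unshelve. all: by end_near. Qed.

End IndependentSamples.

(* Only X0 is bounded everywhere; the samples, having its law, are bounded
   almost surely, so h may be clipped. *)
Lemma sample_average_cvg_bounded_law d d' d0 (T : measurableType d)
    (V : measurableType d') (T0 : measurableType d0) (R : realType)
    (P : probability T R) (P0 : probability T0 R)
    (X : nat -> {RV P >-> V}) (X0 : {RV P0 >-> V}) (h : V -> R) (C : R) :
  measurable_fun setT h -> (forall w, `|h (X0 w)| <= C) ->
  sampled_from X0 X ->
  {ae P, forall w, sample_average h (fun i => X i w) n @[n --> \oo] -->
    \int[P0]_w h (X0 w)}.
Proof.
move=> mh hC smpl; have [_ eqX] := smpl.
have C0 : 0 <= C by rewrite (le_trans _ (hC point)).
pose h' v := Num.max (- C) (Num.min (h v) C).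
have mh' : measurable_fun setT h'.
  by apply: measurable_maxr => //; exact: measurable_minr.
have h'C v : `|h' v| <= C.
  by rewrite ler_norml /h' le_max lexx ge_max ge_min lexx orbT andbT ge0_cp.
have h'E v : `|h v| <= C -> h' v = h v.
  rewrite ler_norml /h' => /andP[Ch hC'].
  by rewrite (min_idPl hC') (max_idPr Ch).
have mbad : measurable (h @^-1` [set r | C < `|r|]).
  rewrite -[X in measurable X]setTI; apply: mh => //.
  rewrite [X in measurable X](_ : _ = Num.norm @^-1` `]C, +oo[); last first.
    by apply/seteqP; split => r /=; rewrite in_itv/= andbT.
  by rewrite -[X in measurable X]setTI; exact: normr_measurable.
have bounded_ae : {ae P, forall w, forall i, `|h (X i w)| <= C}.
  apply: ae_foralln => i; exists (X i @^-1` (h @^-1` [set r | C < `|r|])).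
  split; first by rewrite -[X in measurable X]setTI; exact: measurable_funPT.
    (* Under the law of [X0] the bad set is null because its preimage is empty. *)
    apply: (eq_trans (eqX i _ mbad)); rewrite /distribution /pushforward.
    rewrite (_ : _ @^-1` _ = set0) ?measure0//.
    by apply/seteqP; split => // w /=; rewrite ltNge hC.
  by move=> w /=; rewrite ltNge => /negP.
have := sample_average_cvg mh' h'C smpl; apply: filterS2 bounded_ae => w hw.
have -> : \int[P0]_w' h' (X0 w') = \int[P0]_w' h (X0 w').
  by apply: eq_Rintegral => w' _; exact: h'E.
move=> cv; apply: cvg_trans cv; apply: near_eq_cvg; apply: nearW => n.
rewrite /sample_average.
by congr (_ * _); apply: eq_bigr => i _; rewrite h'E.
Qed.

(** * Optimal values over a finite feasible set, enumerated by [e] *)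

Section OptimalValue.
Context {R : realType} {I : finType} {X : Type} (e : I -> X) (D : set X).
Hypotheses (De : D `<=` range e) (D0 : D !=set0).

Lemma optimal_value_attained (f : X -> R) :
  exists x, [/\ D x, forall y, D y -> f y <= f x &
    optimal_value D (EFin \o f) = (f x)%:E].
Proof.
have [x0 Dx0] := D0; have [i0 _ ei0] := De Dx0.
pose p i := `[< D (e i) >].
have pi0 : p i0 by apply/asboolP; rewrite ei0.
have [i /asboolP Di imax] := arg_maxP (f \o e) pi0.
have max y : D y -> f y <= f (e i).
  move=> Dy; have [j _ ej] := De Dy; rewrite -ej; apply: imax.
  by apply/asboolP; rewrite ej.
exists (e i); split => //; apply/eqP; rewrite eq_le; apply/andP; split.
  by apply: ge_ereal_sup => _ [y Dy <-]; rewrite lee_fin max.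
by apply: ereal_sup_ubound; exists (e i).
Qed.

Lemma optimal_value_fin_num (f : X -> R) :
  optimal_value D (EFin \o f) \is a fin_num.
Proof. by have [x [_ _ ->]] := optimal_value_attained f. Qed.

(** On a finite set pointwise convergence is uniform, and functions within eps of each other have
    maxima within eps, even though the maximizer of [f n] may vary with n. *)
Lemma cvg_optimal_value (f : nat -> X -> R) (g : X -> R) :
  (forall x, D x -> f n x @[n --> \oo] --> g x) ->
  optimal_value D (EFin \o f n) @[n --> \oo] --> optimal_value D (EFin \o g).
Proof.
move=> fg; have [x [Dx xmax ->]] := optimal_value_attained g.
have [y yP] := choice (fun n => optimal_value_attained (f n)).
rewrite (_ : (fun n => _) = EFin \o (fun n => f n (y n))); last first.
  by apply/funext => n /=; have [_ _ ->] := yP n.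
apply: cvg_EFin; first exact: nearW.
apply/cvgrPdist_le => eps eps0.
have unif : \forall n \near \oo, forall i,
    D (e i) -> `|g (e i) - f n (e i)| <= eps.
  apply: filter_forall => i.
  have [Di|Di] := pselect (D (e i)); last exact: nearW.
  have /cvgrPdist_le/(_ _ eps0) := fg _ Di.
  by apply: filterS => n + _.
apply: filterS unif => n unif /=.
have {}unif z : D z -> `|g z - f n z| <= eps.
  by move=> Dz; have [i _ ei] := De Dz; rewrite -ei; apply: unif; rewrite ei.
have [Dy ymax _] := yP n.
(* Each maximizer is tested in the other problem: g x >= g (y n) >= f n (y n) - eps, and f n (y n)
   >= f n x >= g x - eps. *)
have := unif _ Dy; have := unif _ Dx; have := ymax _ Dx; have := xmax _ Dy.
by rewrite !ler_norml; lra.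
Qed.

End OptimalValue.

(** All terms of the capacity sum are nonnegative, so each single one is at most W. *)
Lemma feasible_bounded (R : realType) (K : nat) (W : R) (w : 'I_K -> R) :
  (forall k, 0 < w k) -> exists N, forall x k, feasible W w x -> (x k <= N)%N.
Proof.
move=> w0; exists (\max_k Num.truncn (W / w k))%N => x k /= xW.
apply: leq_trans (leq_bigmax k).
have h : (x k)%:R <= W / w k.
  rewrite ler_pdivlMr// (le_trans _ xW)// mulrC (bigD1 k)//= lerDl.
  by apply: sumr_ge0 => j _; rewrite mulr_ge0// ltW.
by rewrite truncn_ge_nat// (le_trans _ h).
Qed.

(** * Convergence of the optimal values of the sample average approximations *)

Theorem theorem1 (R : realType) (K : nat)
    (W : R) (w : 'I_K -> R)
    (Tminus T Tplus : R) (phi b : R) (c xi : 'I_K -> R)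
    (hW : 0 < W) (hw : forall k, 0 < w k)
    (hT : Tminus < T) (hTplus : T < Tplus)
    (hb : 0 < b) (hc : forall k, 1 < c k) (hxi : forall k, Tplus < xi k)
    (d0 : measure_display) (Omega0 : measurableType d0)
    (P0 : probability Omega0 R) (Q : {RV P0 >-> K.-tuple (demand_seq R)})
    (hQ : forall omega k, is_net_demand Tminus Tplus (tnth (Q omega) k))
    (d : measure_display) (Omega : measurableType d)
    (P : probability Omega R)
    (Qs : nat -> {RV P >-> K.-tuple (demand_seq R)})
    (hQs : sampled_from Q Qs) :
  let B k := deprivation_reduction phi b (c k) (xi k) Tplus in
  let G (x : 'I_K -> nat) : \bar R :=
    ('E_P0[fun omega => total_reduction B x (Q omega)])%E in
  let GPsi (Psi : nat) (omega : Omega) (x : 'I_K -> nat) : R :=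
    sample_average (total_reduction B x) (fun psi => Qs psi omega) Psi in
  let pi_opt := optimal_value (feasible W w) G in
  let Pi_opt (Psi : nat) (omega : Omega) :=
    optimal_value (feasible W w) (fun x => (GPsi Psi omega x)%:E) in
  {ae P, forall omega,
    limn_esup (fun Psi => `| Pi_opt Psi omega - pi_opt |%E) = 0%E /\
    Pi_opt Psi omega @[Psi --> \oo] --> pi_opt}.
Proof.
move=> B G GPsi pi_opt Pi_opt.
have mtot x : measurable_fun setT (total_reduction B x).
  apply: measurable_total_reduction => k.
  exact: measurable_deprivation_reduction.
pose C (x : 'I_K -> nat) := \sum_(k < K) (x k)%:R * Num.max (B k Tminus) 0.
have totC x omega : `|total_reduction B x (Q omega)| <= C x.
  have red k : 0 <= cost_reduction (B k) (x k)%:R (tnth (Q omega) k) <=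
      (x k)%:R * Num.max (B k Tminus) 0.
    apply: cost_reduction_itv => j js; apply: deprivation_reduction_itv => //.
    by have [_ /(_ _ js)/andP[]] := hQ omega k.
  rewrite ger0_norm; first by apply: ler_sum => k _; have /andP[] := red k.
  by apply: sumr_ge0 => k _; have /andP[] := red k.
pose g x := \int[P0]_omega total_reduction B x (Q omega).
(* The expectation is an extended real; boundedness of the total reduction makes it finite. *)
have GE : G = EFin \o g.
  apply/funext => x; rewrite /G unlock /= fineK//.
  apply: integrable_fin_num => //.
  apply: bounded_integrable (totC x).
  exact: measurableT_comp (mtot x) (measurable_funPT Q).
have [N feasN] := @feasible_bounded R K W w hw.
(* The box of vectors with entries at most N contains the feasible set, and possibly infeasible
   vectors too. *)
pose e (y : {ffun 'I_K -> 'I_N.+1}) k : nat := y k.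
have feas_e : feasible W w `<=` range e.
  move=> x fx; exists [ffun k => inord (x k)] => //.
  by apply/funext => k; rewrite /e ffunE inordK// ltnS feasN.
have feas0 : feasible W w !=set0.
  by exists (fun=> 0%N); rewrite /feasible/= big1 ?ltW// => k _; rewrite mulr0.
(* As the box is finite, one null set serves all its vectors. *)
have cvgG : {ae P, forall omega, forall y,
    GPsi Psi omega (e y) @[Psi --> \oo] --> g (e y)}.
  apply: filter_forall => y.
  exact: (sample_average_cvg_bounded_law (mtot _) (totC _) hQs).
apply: filterS cvgG => omega cvgG.
have cvgPi : Pi_opt Psi omega @[Psi --> \oo] --> pi_opt.
  rewrite /pi_opt GE; apply: (cvg_optimal_value feas_e feas0) => x fx.
  by have [y _ <-] := feas_e _ fx.
split => //.
have fin : pi_opt \is a fin_num.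
  by rewrite /pi_opt GE; exact: (optimal_value_fin_num feas_e).
(* Finiteness of [pi_opt] makes the extended subtraction continuous here and its limit 0; the upper
   limit of a convergent sequence is its limit. *)
have : `|Pi_opt Psi omega - pi_opt|%E @[Psi --> \oo] --> `|pi_opt - pi_opt|%E.
  apply: cvg_abse; apply: cvgeB => //; last exact: cvg_cst.
  by rewrite fin_num_adde_defl// fin_numN.
by rewrite subee// abse0 => /cvg_limn_einf_sup[].
Qed.
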